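(* On the box $\overline B_\infty(\widehat x,1/32)\subset\mathbb R^6$, which contains the segment from $\widehat x$ to $x^\ast$, the coefficients $\mathfrak D_{\mathrm{KS}}$ and $\mathfrak E_{\mathrm{KS}}$ admit the Lipschitz bounds $$L_D:=\sup|\nabla\mathfrak D_{\mathrm{KS}}|\le53\,890,\qquad L_E:=\sup|\nabla\mathfrak E_{\mathrm{KS}}|\le49\,688.$$ Together with $|x^\ast-\widehat x|\le\delta_0\le2.45\cdot10^{-13}$, $$L_D\,\delta_0\le1.4\cdot10^{-8}<6609,\qquad L_E\,\delta_0\le1.3\cdot10^{-8}<1407.$$ Consequently, with $\delta_{\mathrm{KS}}=|x^\ast-\widehat x|$, one has $\delta_{\mathrm{KS}}<\min\{\widehat\nu_2-s,\tfrac12(\widehat\nu_+-\widehat\nu_2)\}$ and $\delta_{\mathrm{KS}}<\min\{6609/L_D,1407/L_E\}$, and $$\mathfrak D_{\mathrm{KS}}(x^\ast)>6609-2\cdot10^{-8}>0,\qquad\mathfrak E_{\mathrm{KS}}(x^\ast)<-1407+2\cdot10^{-8}<0.$$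
   Context: Rational data of the Krupa–Székelyhidi (KS) fan (hats denote these values; $s=\widehat s$): $\widehat\rho_0=\frac{2708112612978501}{2^{48}}$, $\widehat\rho_1=\frac{6811063536043807}{2^{49}}$, $\widehat\rho_2=\frac{2057060350258899}{2^{49}}$, $\widehat\rho_3=\frac{3062207031116133}{2^{48}}$; $\widehat e_0=-\frac{5041529442624971}{2^{41}}$, $\widehat e_1=-\frac{5015532875605977}{2^{41}}$, $\widehat e_2=-\frac{5073206593829053}{2^{41}}$, $\widehat e_3=-\frac{2515400677054201}{2^{40}}$; $\widehat v_{-1}=-\frac{4098844157247653}{2^{46}}$, $\widehat v_{+1}=\frac{3603433899522037}{2^{49}}$, $\widehat s=-\frac{996118042660627}{2^{46}}$; $\widehat C_1=\frac{510415269881361}{2^{37}}$, $\widehat C_2=\frac{1515879700153707}{2^{41}}$, $\widehat C_3=\frac{1855257252703141}{2^{43}}$; $\widehat\nu_-=-\frac{6486283176597739958874052307549}{196306040423407104692364247040}$, $\widehat\nu_1=-\frac{1153852086001065889673487658885}{60824224363690518566334889984}$, $\widehat\nu_2=-\frac{4856156003780791}{2^{49}}$, $\widehat\nu_+=\frac{7162856387903725}{2^{49}}$. Put $H_\pm^{\mathrm c}=\widehat\rho_0[\tfrac12(\widehat v_{\pm1}^2+s^2)+\widehat e_0]$, $\Lambda_\pm^{\mathrm c}=\widehat\rho_0[\tfrac12(\widehat v_{\pm1}^2+s^2)-\widehat e_0]$, $\widehat H_i^{\mathrm{KS}}=\widehat\rho_i(\tfrac12\widehat C_i+\widehat e_i)$,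 $\widehat\Lambda_i^{\mathrm{KS}}=\widehat\rho_i(\tfrac12\widehat C_i-\widehat e_i)$ ($i=1,2$), $q_3=\tfrac12\widehat C_3-\widehat e_3$, $r_3=\tfrac12\widehat C_3+\widehat e_3$. Parameter vector: $x=(\alpha_3,\beta_3,\delta_3,\rho_3,\nu_+,\nu_2)\in\mathbb R^6$; $\widehat x=(\widehat\alpha_3,\widehat\beta_3,\widehat\delta_3,\widehat\rho_3,\widehat\nu_+,\widehat\nu_2)$ with $\widehat\alpha_3,\widehat\beta_3,\widehat\delta_3$ fixed rational numbers on which the coefficients do not depend. With $\rho=\rho_3,\nu=\nu_+,\widetilde\nu=\nu_2$ (and $e(\rho_3)$, $C_3$ held at $\widehat e_3,\widehat C_3$), $$\mathfrak D_{\mathrm{KS}}(x)=(\widehat\nu_1-\widehat\nu_-)(\Lambda_-^{\mathrm c}-\widehat\Lambda_1^{\mathrm{KS}})+(s-\widehat\nu_1)(\Lambda_-^{\mathrm c}-\widehat\Lambda_2^{\mathrm{KS}})+(\widetilde\nu-s)(\Lambda_+^{\mathrm c}-\widehat\Lambda_2^{\mathrm{KS}})+(\nu-\widetilde\nu)(\Lambda_+^{\mathrm c}-q_3\rho),$$ $$\mathfrak E_{\mathrm{KS}}(x)=(\widehat\nu_1-\widehat\nu_-)(\widehat H_1^{\mathrm{KS}}-H_-^{\mathrm c})+(s-\widehat\nu_1)(\widehat H_2^{\mathrm{KS}}-H_-^{\mathrm c})+(\widetilde\nu-s)(\widehat H_2^{\mathrm{KS}}-H_+^{\mathrm c})+(\nu-\widetilde\nu)(r_3\rho-H_+^{\mathrm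 c}).$$ $x^\ast\in\mathbb R^6$ is the parameter vector of the exact KS fan; the only property of it used is that $|x^\ast-\widehat x|\le\delta_0$ for a number $\delta_0$ with $0<\delta_0\le2.45\cdot10^{-13}$. $|\cdot|$ is the Euclidean norm, and $\overline B_\infty(\widehat x,r)=\{x:\max_k|x_k-\widehat x_k|\le r\}$; suprema in $L_D,L_E$ are over $\overline B_\infty(\widehat x,1/32)$. *)

(* Defs.v *)
From Stdlib Require Import Reals.
From mathcomp Require Import all_boot all_order all_algebra.
From mathcomp Require Import all_classical all_reals all_analysis.
From mathcomp Require Import Rstruct Rstruct_topology.
Import numFieldNormedType.Exports.

Set Implicit Arguments.
Unset Strict Implicit.
Unset Printing Implicit Defensive.

(* Both ring_scope and R_scope are delimited by %R; here %R is R_scope, so that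
   numerals are binary (IZR), and ring_scope gets %ring. *)
Delimit Scope ring_scope with ring.
Delimit Scope R_scope with R.
Local Open Scope classical_set_scope.
Local Open Scope R_scope.

Definition hat_rho0 : R := 2708112612978501 / 2 ^ 48.
Definition hat_rho1 : R := 6811063536043807 / 2 ^ 49.
Definition hat_rho2 : R := 2057060350258899 / 2 ^ 49.
Definition hat_rho3 : R := 3062207031116133 / 2 ^ 48.

Definition hat_e0 : R := - (5041529442624971 / 2 ^ 41).
Definition hat_e1 : R := - (5015532875605977 / 2 ^ 41).
Definition hat_e2 : R := - (5073206593829053 / 2 ^ 41).
Definition hat_e3 : R := - (2515400677054201 / 2 ^ 40).

Definition hat_v_minus : R := - (4098844157247653 / 2 ^ 46).
Definition hat_v_plus : R := 3603433899522037 / 2 ^ 49.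
Definition hat_s : R := - (996118042660627 / 2 ^ 46).

Definition hat_C1 : R := 510415269881361 / 2 ^ 37.
Definition hat_C2 : R := 1515879700153707 / 2 ^ 41.
Definition hat_C3 : R := 1855257252703141 / 2 ^ 43.

Definition hat_nu_minus : R :=
  - (6486283176597739958874052307549 / 196306040423407104692364247040).
Definition hat_nu1 : R :=
  - (1153852086001065889673487658885 / 60824224363690518566334889984).
Definition hat_nu2 : R := - (4856156003780791 / 2 ^ 49).
Definition hat_nu_plus : R := 7162856387903725 / 2 ^ 49.

(* H^c_{+-} and Lambda^c_{+-} as functions of the velocity v_{+-1}. *)
Definition Hc (v : R) : R := hat_rho0 * (1 / 2 * (v ^ 2 + hat_s ^ 2) + hat_e0).
Definition Lambdac (v : R) : R := hat_rho0 * (1 / 2 * (v ^ 2 + hat_s ^ 2) - hat_e0).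
Definition Hc_minus : R := Hc hat_v_minus.
Definition Hc_plus : R := Hc hat_v_plus.
Definition Lambdac_minus : R := Lambdac hat_v_minus.
Definition Lambdac_plus : R := Lambdac hat_v_plus.

Definition H1_KS : R := hat_rho1 * (1 / 2 * hat_C1 + hat_e1).
Definition H2_KS : R := hat_rho2 * (1 / 2 * hat_C2 + hat_e2).
Definition Lambda1_KS : R := hat_rho1 * (1 / 2 * hat_C1 - hat_e1).
Definition Lambda2_KS : R := hat_rho2 * (1 / 2 * hat_C2 - hat_e2).
Definition q_3 : R := 1 / 2 * hat_C3 - hat_e3.
Definition r_3 : R := 1 / 2 * hat_C3 + hat_e3.

(* Parameter vectors are (alpha_3, beta_3, delta_3, rho_3, nu_+, nu_2). *)
Definition rho_of (x : 'rV[R]_6) : R := x ord0 (inord 3).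
Definition nu_plus_of (x : 'rV[R]_6) : R := x ord0 (inord 4).
Definition nu2_of (x : 'rV[R]_6) : R := x ord0 (inord 5).

Definition xhat (alpha3 beta3 delta3 : rat) : 'rV[R]_6 :=
  \row_k nth 0 [:: ratr alpha3; ratr beta3; ratr delta3;
                   hat_rho3; hat_nu_plus; hat_nu2] k.

(* e(rho_3) and C_3 are frozen at hat_e3, hat_C3 (inside q_3 and r_3): the only
   dependence on x is through the last three coordinates. *)
Definition D_KS (x : 'rV[R]_6) : R :=
  let rho := rho_of x in let nu := nu_plus_of x in let nut := nu2_of x in
  (hat_nu1 - hat_nu_minus) * (Lambdac_minus - Lambda1_KS)
  + (hat_s - hat_nu1) * (Lambdac_minus - Lambda2_KS)
  + (nut - hat_s) * (Lambdac_plus - Lambda2_KS)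
  + (nu - nut) * (Lambdac_plus - q_3 * rho).

Definition E_KS (x : 'rV[R]_6) : R :=
  let rho := rho_of x in let nu := nu_plus_of x in let nut := nu2_of x in
  (hat_nu1 - hat_nu_minus) * (H1_KS - Hc_minus)
  + (hat_s - hat_nu1) * (H2_KS - Hc_minus)
  + (nut - hat_s) * (H2_KS - Hc_plus)
  + (nu - nut) * (r_3 * rho - Hc_plus).

(* The library's norm on 'rV[R]_n is the sup norm; enorm is the Euclidean one. *)
Definition enorm n (x : 'rV[R]_n) : R := sqrt (\sum_k x ord0 k ^+ 2)%ring.

Definition cball_sup n (c : 'rV[R]_n) (r : R) : set 'rV[R]_n :=
  [set x | `|x - c|%ring <= r].

(* The 'D_v are total: this is the gradient only where f is differentiable. *)
Definition grad n (f : 'rV[R]_n -> R) (x : 'rV[R]_n) : 'rV[R]_n :=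
  \row_k 'D_(delta_mx ord0 k) (f : 'rV[R]_n -> (R^o)%ring) x.

Definition grad_norms n (f : 'rV[R]_n -> R) (B : set 'rV[R]_n) : set R :=
  [set enorm (grad f x) | x in B].

(* sup is total: its value is the least upper bound only for sets satisfying
   has_sup. *)
Definition grad_sup n (f : 'rV[R]_n -> R) (B : set 'rV[R]_n) : R :=
  sup (grad_norms f B).

(* Main.v *)
Require Import Defs.
From Stdlib Require Import Reals Lra.
From HB Require Import structures.
From mathcomp Require Import all_boot all_order all_algebra.
From mathcomp Require Import all_classical all_reals all_analysis.
From mathcomp Require Import Rstruct Rstruct_topology.
From mathcomp Require Import ring.
Import Order.TTheory GRing.Theory Num.Theory.
Import numFieldNormedType.Exports.
Delimit Scope ring_scope with ring.
Delimit Scope R_scope with R.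
Local Open Scope classical_set_scope.
Local Open Scope R_scope.

(** Since $e(\rho_3)$ and $C_3$ are held constant, both coefficients are
    polynomials of the single shape
    $c + a\,\nu_2 + (\nu_+ - \nu_2)(k\rho_3 + b)$ ([front_form]), so everything
    reduces to this shape and to arithmetic with the rational data.

    The gradient has the three nonzero entries $k(\nu_+ - \nu_2)$,
    $k\rho_3 + b$ and $a - (k\rho_3 + b)$ ([grad_front_form]), each affine in
    $x$.  On the box each entry is bounded separately, which is enough for the
    constants 53890 and 49688 because the three entries happen to be largest at
    the same corner of the box ([enorm_grad_D_KS_le], [enorm_grad_E_KS_le]).

    The Lipschitz bound with the exact supremum as constant comes from an
    identity: for a polynomial of degree two the increment $f(x) - f(y)$ equals
    the gradient at the midpoint of $x$ and $y$ paired with $x - y$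
    ([front_form_midpoint]).  The midpoint stays in the box, and the
    Cauchy--Schwarz inequality concludes ([midpoint_lipschitz]).

    Evaluated at the rational point, the coefficients are
    $\mathfrak D_{KS} \approx 6609.68$ and $\mathfrak E_{KS} \approx -1407.036$.
    Passing to $x^\ast$ changes them by at most $L\,\delta_0 < 2\cdot10^{-8}$,
    so the signs persist. *)

(** * The Euclidean norm *)

Lemma enormE n (x : 'rV[R]_n) :
  enorm x = Num.sqrt (\sum_k x ord0 k ^+ 2)%ring.
Proof. by rewrite /enorm RsqrtE. Qed.

Lemma enorm_ge0 n (x : 'rV[R]_n) : (0 <= enorm x)%ring.
Proof. by rewrite enormE sqrtr_ge0. Qed.

Lemma sqr_enorm n (x : 'rV[R]_n) :
  (enorm x ^+ 2 = \sum_k x ord0 k ^+ 2)%ring.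
Proof. by rewrite enormE sqr_sqrtr // sumr_ge0 // => k _; exact: sqr_ge0. Qed.

(** Cauchy--Schwarz: with $A = |x|^2$, $B = |y|^2$ and $c = x\cdot y$, the
    vector $Bx - cy$ has squared length $B(AB - c^2)$, which is therefore
    nonnegative. *)
Lemma dot_le_enorm n (x y : 'rV[R]_n) :
  (`|\sum_k x ord0 k * y ord0 k| <= enorm x * enorm y)%ring.
Proof.
rewrite -ler_sqr ?nnegrE ?normr_ge0 ?mulr_ge0 ?enorm_ge0 //.
rewrite real_normK ?num_real // exprMn !sqr_enorm.
set A := (\sum_k x _ k ^+ 2)%ring; set B := (\sum_k y _ k ^+ 2)%ring.
set c := (\sum_k _)%ring.
have expand (s t : R) : (\sum_k (s * x ord0 k - t * y ord0 k) ^+ 2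
                         = s ^+ 2 * A - s * t * 2 * c + t ^+ 2 * B)%ring.
  rewrite !mulr_sumr -sumrB -big_split /=; apply: eq_bigr => k _.
  ring.
have pos : (0 <= B * (A * B - c ^+ 2))%ring.
  have -> : (B * (A * B - c ^+ 2)
             = B ^+ 2 * A - B * c * 2 * c + c ^+ 2 * B)%ring by ring.
  by rewrite -expand sumr_ge0 // => k _; exact: sqr_ge0.
have : (0 <= B)%ring by rewrite sumr_ge0 // => k _; exact: sqr_ge0.
rewrite le_eqVlt => /orP[/eqP B0|B_gt0].
  (* |y| = 0 forces y = 0, hence c = 0 *)
  suff -> : c = 0%ring by rewrite expr0n -B0 mulr0.
  apply: big1 => k _; apply/eqP; rewrite mulf_eq0 -[y _ _ == _]sqrf_eq0.
  have /eqP := esym B0.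
  rewrite psumr_eq0 => [/allP/(_ k)|l _]; last exact: sqr_ge0.
  by rewrite mem_index_enum => /(_ isT) /= ->; rewrite orbT.
by rewrite -subr_ge0 -(pmulr_rge0 _ B_gt0).
Qed.

Lemma coord_le_norm n (x : 'rV[R]_n) k : (`|x ord0 k| <= `|x|)%ring.
Proof.
rewrite /Num.norm /= mx_normrE.
exact: (le_bigmax_cond _ (fun ij => `|x ij.1 ij.2|%ring) (j := (ord0, k))).
Qed.

Lemma norm_le_enorm n (x : 'rV[R]_n) : (`|x| <= enorm x)%ring.
Proof.
rewrite /Num.norm /= mx_normrE; apply: bigmax_le => [|[i k] _ /=].
  exact: enorm_ge0.
rewrite ord1 enormE -sqrtr_sqr ler_wsqrtr // (bigD1 k) //= lerDl.
by rewrite sumr_ge0 // => l _; exact: sqr_ge0.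
Qed.

Lemma cball_sup_coord n (c x : 'rV[R]_n) r k :
  cball_sup c r x -> Rabs (x ord0 k - c ord0 k) <= r.
Proof.
move=> /RleP xB; apply/RleP; rewrite RabsE RealsE.
by apply: le_trans xB; have := @coord_le_norm _ (x - c)%ring k; rewrite !mxE.
Qed.

Lemma cball_sup_segment n (c x : 'rV[R]_n) r t :
  enorm (x - c)%ring <= r -> 0 <= t <= 1 ->
  cball_sup c r (c + t *: (x - c))%ring.
Proof.
move=> /RleP le_r [/RleP t0 /RleP t1]; rewrite /cball_sup /=; apply/RleP.
rewrite addrC addKr normrZ ger0_norm //.
apply: le_trans (le_trans (norm_le_enorm _ _) le_r).
exact: ler_piMl.
Qed.

(** * Suprema of gradient norms *)

Lemma grad_sup_le n (f : 'rV[R]_n -> R) (B : set 'rV[R]_n) L :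
  B !=set0 -> (forall x, B x -> enorm (grad f x) <= L) ->
  has_sup (grad_norms f B) /\ grad_sup f B <= L.
Proof.
move=> [x0 Bx0] le_L.
have ne : grad_norms f B !=set0 by exists (enorm (grad f x0)); exists x0.
have ub : ubound (grad_norms f B) L.
  by move=> _ [x Bx <-]; apply/RleP; exact: le_L.
by split; [split => //; exists L | apply/RleP; exact: ge_sup].
Qed.

(** Positivity gives the quotients $6609/L_D$ and $1407/L_E$ their meaning. *)
Lemma grad_sup_gt0 n (f : 'rV[R]_n -> R) (B : set 'rV[R]_n) x k :
  has_sup (grad_norms f B) -> B x -> grad f x ord0 k <> 0 -> 0 < grad_sup f B.
Proof.
move=> hs Bx neq0.
have norm_gt0 : 0 < enorm (grad f x).
  apply: (@Rlt_le_trans _ (Rabs (grad f x ord0 k))); first exact: Rabs_pos_lt.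
  apply/RleP; rewrite RabsE.
  exact: le_trans (coord_le_norm _ _ k) (norm_le_enorm _ _).
apply: Rlt_le_trans norm_gt0 _; apply/RleP; apply: sup_upper_bound => //.
by exists x.
Qed.

(** The hypothesis is the exact form that the mean value theorem takes for
    polynomials of degree at most two. *)
Lemma midpoint_lipschitz n (f : 'rV[R]_n -> R) c r x y :
  (f x - f y = \sum_k grad f (2^-1 *: (x + y)) ord0 k * (x - y) ord0 k)%ring ->
  has_sup (grad_norms f (cball_sup c r)) -> cball_sup c r x -> cball_sup c r y ->
  Rabs (f x - f y) <= grad_sup f (cball_sup c r) * enorm (x - y)%ring.
Proof.
move=> mid hs xB yB; apply/RleP; rewrite RabsE.
apply: (@le_trans _ _ (enorm (grad f (2^-1 *: (x + y))%ring)
                       * enorm (x - y)%ring)%ring).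
  by rewrite [X in (`|X|)%ring]mid dot_le_enorm.
apply: ler_wpM2r; first exact: enorm_ge0.
apply: sup_upper_bound => //.
exists (2^-1 *: (x + y))%ring => //; rewrite /cball_sup /=.
have -> : (2^-1 *: (x + y) - c = 2^-1 *: ((x - c) + (y - c)))%ring.
  by apply/rowP => k; rewrite !mxE; field.
move: xB yB; rewrite /cball_sup /= => /RleP xB /RleP yB; apply/RleP.
rewrite normrZ ger0_norm ?invr_ge0 // mulrC ler_pdivrMr //.
by rewrite (le_trans (ler_normD _ _)) // mulr_natr mulr2n lerD.
Qed.

(** * The common shape of the two coefficients *)

(** The difference of the two speeds is the width of the wedge in which the
    density is $\rho_3$; the affine function of $\rho_3$ compares the
    $H$ or $\Lambda$ there with that of the constant state of density $\rho_0$. *)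
Definition front_form (c a k b : R) (x : 'rV[R]_6) : R :=
  (c + a * nu2_of x + (nu_plus_of x - nu2_of x) * (k * rho_of x + b))%ring.

Lemma differentiable_front_form c a k b x :
  differentiable (front_form c a k b : 'rV[R]_6 -> (R^o)%ring) x.
Proof.
have coord j : differentiable (fun y : 'rV[R]_6 => (y ord0 j : (R^o)%ring)) x.
  exact: differentiable_coord.
have const (z : R) : differentiable (fun _ : 'rV[R]_6 => (z : (R^o)%ring)) x.
  exact: differentiable_cst.
apply: differentiableD; [apply: differentiableD => //; apply: differentiableM
  | apply: differentiableM; [apply: differentiableB
  | apply: differentiableD => //; apply: differentiableM]].
all: by [exact: const | exact: coord].
Qed.

Lemma is_derive_coord n (x v : 'rV[R]_n) k :
  is_derive x v (fun y : 'rV[R]_n => (y ord0 k : (R^o)%ring)) (v ord0 k).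
Proof.
have lin : linear (fun y : 'rV[R]_n => (y ord0 k : (R^o)%ring)).
  by move=> a u w; rewrite !mxE.
pose f : {linear 'rV[R]_n -> (R^o)%ring} :=
  HB.pack (fun y : 'rV[R]_n => (y ord0 k : (R^o)%ring))
    (GRing.isLinear.Build _ _ _ _ _ lin).
have df := @differentiable_coord _ _ _ x ord0 k.
apply: DeriveDef; first exact: diff_derivable.
rewrite deriveE //.
by rewrite (diff_lin (f := f)) //; exact: coord_continuous.
Qed.

Lemma is_derive_front_form c a k b (x v : 'rV[R]_6) :
  is_derive x v (front_form c a k b : 'rV[R]_6 -> (R^o)%ring)
    (k * (nu_plus_of x - nu2_of x) * rho_of v
     + (k * rho_of x + b) * nu_plus_of v
     + (a - (k * rho_of x + b)) * nu2_of v)%ring.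
Proof.
have coord i := @is_derive_coord _ x v i.
have const (z : R) :
    is_derive x v (fun _ : 'rV[R]_6 => (z : (R^o)%ring)) 0%ring.
  exact: is_derive_cst.
have Dnu2 := is_deriveM (const a) (coord (inord 5)).
have Dwidth := is_deriveB (coord (inord 4)) (coord (inord 5)).
have Drho := is_deriveD (is_deriveM (const k) (coord (inord 3))) (const b).
apply: (is_derive_eq (is_deriveD (is_deriveD (const c) Dnu2)
                                 (is_deriveM Dwidth Drho))).
rewrite /rho_of /nu_plus_of /nu2_of !fctE /GRing.scale /=.
ring.
Qed.

Lemma grad_front_form c a k b x :
  grad (front_form c a k b) x =
  (\row_j [:: 0; 0; 0; k * (nu_plus_of x - nu2_of x);
            k * rho_of x + b; a - (k * rho_of x + b)]`_j)%ring.
Proof.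
apply/rowP => j; rewrite !mxE.
have [_ ->] := is_derive_front_form c a k b x (delta_mx ord0 j).
rewrite /rho_of /nu_plus_of /nu2_of !mxE -!val_eqE /= !inordK //.
by case: j => [[|[|[|[|[|[|]]]]]] lt_j6] //=; ring.
Qed.

Lemma dot_grad_front_form c a k b (x v : 'rV[R]_6) :
  (\sum_j grad (front_form c a k b) x ord0 j * v ord0 j =
   k * (nu_plus_of x - nu2_of x) * rho_of v
   + (k * rho_of x + b) * nu_plus_of v
   + (a - (k * rho_of x + b)) * nu2_of v)%ring.
Proof.
rewrite grad_front_form.
rewrite (bigD1 (inord 3)) //= (bigD1 (inord 4)) /=; last first.
  by rewrite -val_eqE /= !inordK.
rewrite (bigD1 (inord 5)) /=; last by rewrite -!val_eqE /= !inordK.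
rewrite big1 ?addr0 => [|j]; last first.
  rewrite mxE -!val_eqE /= !inordK //.
  by case: j => [[|[|[|[|[|[|]]]]]] lt_j6] //= _; rewrite mul0r.
by rewrite !mxE !inordK //= addrA.
Qed.

(** The only nonlinear part is the product of the two linear forms
    $p = \nu_+ - \nu_2$ and $q = \rho_3$, for which
    $pq - p'q' = \frac{p+p'}2 (q-q') + \frac{q+q'}2 (p-p')$. *)
Lemma front_form_midpoint c a k b x y :
  (front_form c a k b x - front_form c a k b y =
   \sum_j grad (front_form c a k b) (2^-1 *: (x + y)) ord0 j
          * (x - y) ord0 j)%ring.
Proof.
rewrite dot_grad_front_form /front_form /rho_of /nu_plus_of /nu2_of !mxE.
by field.
Qed.

Lemma enorm_grad_front_form_le c a k b x g3 g4 g5 L :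
  Rabs (k * (nu_plus_of x - nu2_of x)) <= g3 -> Rabs (k * rho_of x + b) <= g4 ->
  Rabs (a - (k * rho_of x + b)) <= g5 ->
  0 <= L -> g3 ^ 2 + g4 ^ 2 + g5 ^ 2 <= L ^ 2 ->
  enorm (grad (front_form c a k b) x) <= L.
Proof.
move=> le3 le4 le5 L0 leL.
rewrite -(sqrt_pow2 L) //; apply: sqrt_le_1_alt.
apply: Rle_trans leL.
have -> : (\sum_j grad (front_form c a k b) x ord0 j ^+ 2)%ring =
    (k * (nu_plus_of x - nu2_of x)) ^ 2 + (k * rho_of x + b) ^ 2
    + (a - (k * rho_of x + b)) ^ 2.
  under eq_bigr do rewrite expr2.
  rewrite dot_grad_front_form grad_front_form /rho_of /nu_plus_of /nu2_of !mxE.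
  by rewrite !inordK //= !Rmult_1_r.
by apply: Rplus_le_compat; [apply: Rplus_le_compat|]; apply: pow_maj_Rabs.
Qed.

Lemma D_KS_front_form : D_KS =
  front_form ((hat_nu1 - hat_nu_minus) * (Lambdac_minus - Lambda1_KS)
    + (hat_s - hat_nu1) * (Lambdac_minus - Lambda2_KS)
    - hat_s * (Lambdac_plus - Lambda2_KS))
  (Lambdac_plus - Lambda2_KS) (- q_3) Lambdac_plus.
Proof. by apply: funext => x; rewrite /D_KS /front_form !RealsE; ring. Qed.

Lemma E_KS_front_form : E_KS =
  front_form ((hat_nu1 - hat_nu_minus) * (H1_KS - Hc_minus)
    + (hat_s - hat_nu1) * (H2_KS - Hc_minus)
    - hat_s * (H2_KS - Hc_plus))
  (H2_KS - Hc_plus) r_3 (- Hc_plus).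
Proof. by apply: funext => x; rewrite /E_KS /front_form !RealsE; ring. Qed.

(** * Numerical bounds on the box *)

Ltac unfold_data :=
  rewrite /q_3 /r_3 /Lambdac_plus /Lambdac_minus /Hc_plus /Hc_minus
    /Lambda1_KS /Lambda2_KS /H1_KS /H2_KS /Lambdac /Hc
    /hat_rho0 /hat_rho1 /hat_rho2 /hat_rho3 /hat_e0 /hat_e1 /hat_e2 /hat_e3
    /hat_v_minus /hat_v_plus /hat_s /hat_C1 /hat_C2 /hat_C3
    /hat_nu_minus /hat_nu1 /hat_nu2 /hat_nu_plus.

Lemma rho_of_xhat alpha3 beta3 delta3 :
  rho_of (xhat alpha3 beta3 delta3) = hat_rho3.
Proof. by rewrite /rho_of mxE inordK. Qed.

Lemma nu_plus_of_xhat alpha3 beta3 delta3 :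
  nu_plus_of (xhat alpha3 beta3 delta3) = hat_nu_plus.
Proof. by rewrite /nu_plus_of mxE inordK. Qed.

Lemma nu2_of_xhat alpha3 beta3 delta3 :
  nu2_of (xhat alpha3 beta3 delta3) = hat_nu2.
Proof. by rewrite /nu2_of mxE inordK. Qed.

Lemma box_coords alpha3 beta3 delta3 x :
  cball_sup (xhat alpha3 beta3 delta3) (1 / 32) x ->
  (- (1 / 32) <= rho_of x - hat_rho3 <= 1 / 32) /\
  (- (1 / 32) <= nu_plus_of x - hat_nu_plus <= 1 / 32) /\
  (- (1 / 32) <= nu2_of x - hat_nu2 <= 1 / 32).
Proof.
set xh := xhat _ _ _ => xB.
rewrite -(rho_of_xhat alpha3 beta3 delta3) -(nu_plus_of_xhat alpha3 beta3 delta3).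
rewrite -(nu2_of_xhat alpha3 beta3 delta3).
have coord k : - (1 / 32) <= x ord0 k - xh ord0 k <= 1 / 32.
  have := @cball_sup_coord _ _ _ _ k xB.
  by rewrite /Rabs; case: Rcase_abs => *; lra.
by split; [|split]; exact: coord.
Qed.

Lemma enorm_grad_D_KS_le alpha3 beta3 delta3 x :
  cball_sup (xhat alpha3 beta3 delta3) (1 / 32) x ->
  enorm (grad D_KS x) <= 53890.
Proof.
move=> /box_coords; rewrite D_KS_front_form.
rewrite /hat_rho3 /hat_nu_plus /hat_nu2 => -[Hr [Hp H2]].
(* the entries are at most 51244.6, 2892.1 and 16421.3 in absolute value *)
apply: (@enorm_grad_front_form_le _ _ _ _ _ 51245 2893 16422);
  [apply: Rabs_le | apply: Rabs_le | apply: Rabs_le | | ]; unfold_data; lra.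
Qed.

Lemma enorm_grad_E_KS_le alpha3 beta3 delta3 x :
  cball_sup (xhat alpha3 beta3 delta3) (1 / 32) x ->
  enorm (grad E_KS x) <= 49688.
Proof.
move=> /box_coords; rewrite E_KS_front_form.
rewrite /hat_rho3 /hat_nu_plus /hat_nu2 => -[Hr [Hp H2]].
(* the true supremum is about 49687.77, so the largest entry, 46728.285, cannot
   be rounded up to an integer *)
apply: (@enorm_grad_front_form_le _ _ _ _ _ 46728.3 2913 16639);
  [apply: Rabs_le | apply: Rabs_le | apply: Rabs_le | | ]; unfold_data; lra.
Qed.

Lemma D_KS_xhat_gt alpha3 beta3 delta3 :
  6609.5 < D_KS (xhat alpha3 beta3 delta3).
Proof.
rewrite /D_KS rho_of_xhat nu_plus_of_xhat nu2_of_xhat; unfold_data; lra.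
Qed.

Lemma E_KS_xhat_lt alpha3 beta3 delta3 :
  E_KS (xhat alpha3 beta3 delta3) < - 1407.03.
Proof.
rewrite /E_KS rho_of_xhat nu_plus_of_xhat nu2_of_xhat; unfold_data; lra.
Qed.

Lemma grad_D_KS_xhat_neq0 alpha3 beta3 delta3 :
  grad D_KS (xhat alpha3 beta3 delta3) ord0 (inord 4) <> 0.
Proof.
rewrite D_KS_front_form grad_front_form mxE inordK //= rho_of_xhat.
rewrite -!RealsE; unfold_data; lra.
Qed.

Lemma grad_E_KS_xhat_neq0 alpha3 beta3 delta3 :
  grad E_KS (xhat alpha3 beta3 delta3) ord0 (inord 4) <> 0.
Proof.
rewrite E_KS_front_form grad_front_form mxE inordK //= rho_of_xhat.
rewrite -!RealsE; unfold_data; lra.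
Qed.

(** * Stability of the signs *)

Lemma lt_div_of_mul_lt (d d0 L K : R) :
  0 < L -> d <= d0 -> L * d0 < K -> d < K / L.
Proof.
move=> L_gt0 le_d lt_K; apply: (@Rmult_lt_reg_l L) => //.
have -> : L * (K / L) = K by rewrite Rmult_div_assoc Rmult_div_r; lra.
by apply: Rle_lt_trans lt_K; apply: Rmult_le_compat_l => //; lra.
Qed.

Theorem theoremA3 (alpha3 beta3 delta3 : rat) (xstar : 'rV[R]_6) (delta0 : R) :
  let xh := xhat alpha3 beta3 delta3 in
  let B := cball_sup xh (1 / 32) in
  let L_D := grad_sup D_KS B in
  let L_E := grad_sup E_KS B in
  let delta_KS := enorm (xstar - xh)%ring in
  0 < delta0 -> delta0 <= 2.45e-13 -> delta_KS <= delta0 ->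
  (forall t : R, 0 <= t <= 1 -> B (xh + t *: (xstar - xh))%ring) /\
  (forall x, B x ->
     differentiable (D_KS : 'rV[R]_6 -> (R^o)%ring) x /\
     differentiable (E_KS : 'rV[R]_6 -> (R^o)%ring) x) /\
  (has_sup (grad_norms D_KS B) /\ L_D <= 53890) /\
  (has_sup (grad_norms E_KS B) /\ L_E <= 49688) /\
  (forall x y, B x -> B y ->
     Rabs (D_KS x - D_KS y) <= L_D * enorm (x - y)%ring /\
     Rabs (E_KS x - E_KS y) <= L_E * enorm (x - y)%ring) /\
  (L_D * delta0 <= 1.4e-8 < 6609) /\
  (L_E * delta0 <= 1.3e-8 < 1407) /\
  delta_KS < Rmin (hat_nu2 - hat_s) (1 / 2 * (hat_nu_plus - hat_nu2)) /\
  delta_KS < Rmin (6609 / L_D) (1407 / L_E) /\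
  (0 < 6609 - 2e-8 < D_KS xstar) /\
  (E_KS xstar < - 1407 + 2e-8 < 0).
Proof.
move=> xh B L_D L_E delta_KS delta0_gt0 delta0_le delta_le.
have segment t : 0 <= t <= 1 -> B (xh + t *: (xstar - xh))%ring.
  by apply: cball_sup_segment; apply: Rle_trans delta_le _; lra.
have Bxh : B xh by have := segment 0; rewrite scale0r addr0; apply; lra.
have Bxstar : B xstar.
  by have := segment 1; rewrite scale1r addrC subrK; apply; lra.
have neB : B !=set0 by exists xh.
have [supD leD] : has_sup (grad_norms D_KS B) /\ L_D <= 53890.
  by apply: grad_sup_le => // x; exact: enorm_grad_D_KS_le.
have [supE leE] : has_sup (grad_norms E_KS B) /\ L_E <= 49688.
  by apply: grad_sup_le => // x; exact: enorm_grad_E_KS_le.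
have L_D_gt0 : 0 < L_D.
  exact: grad_sup_gt0 supD Bxh (grad_D_KS_xhat_neq0 _ _ _).
have L_E_gt0 : 0 < L_E.
  exact: grad_sup_gt0 supE Bxh (grad_E_KS_xhat_neq0 _ _ _).
have lipD x y : B x -> B y -> Rabs (D_KS x - D_KS y) <= L_D * enorm (x - y)%ring.
  move=> Bx By; apply: midpoint_lipschitz => //.
  by rewrite D_KS_front_form; exact: front_form_midpoint.
have lipE x y : B x -> B y -> Rabs (E_KS x - E_KS y) <= L_E * enorm (x - y)%ring.
  move=> Bx By; apply: midpoint_lipschitz => //.
  by rewrite E_KS_front_form; exact: front_form_midpoint.
have L_D_delta0 : L_D * delta0 <= 1.4e-8.
  apply: (@Rle_trans _ (53890 * 2.45e-13)); last lra.
  by apply: Rmult_le_compat; lra.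
have L_E_delta0 : L_E * delta0 <= 1.3e-8.
  apply: (@Rle_trans _ (49688 * 2.45e-13)); last lra.
  by apply: Rmult_le_compat; lra.
split; first exact: segment.
split.
  by move=> x _; rewrite D_KS_front_form E_KS_front_form;
    split; exact: differentiable_front_form.
split; first exact: (conj supD leD).
split; first exact: (conj supE leE).
split; first by move=> x y Bx By; split; [exact: lipD | exact: lipE].
split; first by split; [exact: L_D_delta0 | lra].
split; first by split; [exact: L_E_delta0 | lra].
split; first by apply: Rmin_glb_lt; unfold_data; lra.
split.
  by apply: Rmin_glb_lt; apply: lt_div_of_mul_lt delta_le _; lra.
split; [split; first lra | split; last lra].
- have := lipD _ _ Bxstar Bxh; have := D_KS_xhat_gt alpha3 beta3 delta3.
  rewrite -/xh -/delta_KS => lbD.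
  have := Rmult_le_compat_l _ _ _ (Rlt_le _ _ L_D_gt0) delta_le.
  by rewrite /Rabs; case: Rcase_abs => *; lra.
- have := lipE _ _ Bxstar Bxh; have := E_KS_xhat_lt alpha3 beta3 delta3.
  rewrite -/xh -/delta_KS => ubE.
  have := Rmult_le_compat_l _ _ _ (Rlt_le _ _ L_E_gt0) delta_le.
  by rewrite /Rabs; case: Rcase_abs => *; lra.
Qed.
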